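(* Let $T>0$, let $u_0:[0,1]\to\mathbb{R}$ be continuous and $b:\mathbb{R}\to\mathbb{R}$ Lipschitz. For $n\in\mathbb{N}$ let $\{\theta_n(t,x),\ (t,x)\in[0,T]\times[0,1]\}$ be stochastic processes with $\theta_n\in L^2([0,T]\times[0,1])$ a.s. Suppose that $X_n(t,x)=\int_0^t\int_0^1G_{t-s}(x,y)\theta_n(s,y)\,dy\,ds$ converges in law, as $n\to\infty$, in $\mathcal{C}([0,T]\times[0,1])$, to $X(t,x)=\int_0^t\int_0^1G_{t-s}(x,y)W(ds,dy)$, where $W$ is a Brownian sheet on $[0,T]\times[0,1]$. Then the mild solutions $U_n$ of $\partial_tU_n-\partial_{xx}U_n=b(U_n)+\theta_n$ converge in law, in $\mathcal{C}([0,T]\times[0,1])$, to the mild solution $U$ of $\partial_tU-\partial_{xx}U=b(U)+\dot W$, both with initial condition $u_0$ and Dirichlet boundary conditions.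
   Context: $G_t(x,y)=2\sum_{k\ge1}\sin(k\pi x)\sin(k\pi y)e^{-k^2\pi^2 t}$ is the Green function of the heat equation on $[0,1]$ with Dirichlet boundary conditions. The mild solution $U$ is the unique continuous process adapted to the (completed) natural filtration of $W$ with, a.s. for all $(t,x)$, $U(t,x)=\int_0^1G_t(x,y)u_0(y)dy+\int_0^t\int_0^1G_{t-s}(x,y)b(U(s,y))\,dy\,ds+\int_0^t\int_0^1G_{t-s}(x,y)W(ds,dy)$ (Wiener integral); $U_n$ is the unique a.s. continuous process with $U_n(t,x)=\int_0^1G_t(x,y)u_0(y)dy+\int_0^t\int_0^1G_{t-s}(x,y)b(U_n(s,y))\,dy\,ds+\int_0^t\int_0^1G_{t-s}(x,y)\theta_n(s,y)\,dy\,ds$. *)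

(* Defs.v *)
From HB Require Import structures.
From mathcomp Require Import all_boot all_order all_algebra.
From mathcomp Require Import all_classical all_reals all_analysis.
Set Implicit Arguments.
Unset Strict Implicit.
Unset Printing Implicit Defensive.
Import Order.TTheory GRing.Theory Num.Theory.
Import numFieldNormedType.Exports.
Local Open Scope classical_set_scope.
Local Open Scope ring_scope.

Section Defs.
Context {R : realType}.

Definition stdom (T : R) : set (R * R) := `[0, T] `*` `[0, 1].

Definition lebR := (@lebesgue_measure R).
Definition lebR2 := (lebR \x lebR)%E.

(** Dirichlet heat kernel on [0,1]:
    G_t(x,y) = 2 sum_{k>=1} sin(k pi x) sin(k pi y) exp(-k^2 pi^2 t),
    the series being the limit of its partial sums. *)
Definition Green (t x y : R) : R :=
  2 * limn (fun n : nat => \sum_(1 <= k < n)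
      (sin (k%:R * pi * x) * sin (k%:R * pi * y)
       * expR (- (k%:R ^+ 2 * pi ^+ 2 * t)))).

(** Action of the heat semigroup on the initial condition
    (at t = 0 it is the identity, i.e. G_0(x, .) = delta_x). *)
Definition heat_sg (u0 : R -> R) (t x : R) : R :=
  if t == 0 then u0 x
  else \int[lebR]_(y in `[0, 1]) (Green t x y * u0 y).

Definition heat_conv (f : R * R -> R) (t x : R) : R :=
  \int[lebR]_(s in `[0, t]) \int[lebR]_(y in `[0, 1]) (Green (t - s) x y * f (s, y)).

Definition sq_int (T : R) (h : R * R -> R) : Prop :=
  measurable_fun (stdom T) h /\
  (\int[lebR2]_(z in stdom T) ((h z) ^+ 2)%:E < +oo)%E.
Definition L2norm2 (T : R) (h : R * R -> R) : R :=
  \int[lebR2]_(z in stdom T) ((h z) ^+ 2).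

Section Prob.
Context {d : measure_display} {Omega : measurableType d}
        (P : probability Omega R).

Definition centered_gaussian (X : Omega -> R) (v : R) : Prop :=
  if v == 0 then {ae P, forall w, X w = 0}
  else forall A : set R, measurable A ->
         P (X @^-1` A) = normal_prob 0 (Num.sqrt v) A.

(** Space-time white noise on [0,T] x [0,1] (Walsh): an isonormal Gaussian
    process indexed by L^2([0,T] x [0,1]).  W h is the Wiener integral
    int int h(s,y) W(ds,dy) with respect to the Brownian sheet
    B(t,x) = W (1_{[0,t] x [0,x]}). *)
Definition white_noise (T : R) (W : (R * R -> R) -> Omega -> R) : Prop :=
  (forall h, sq_int T h ->
     measurable_fun setT (W h) /\ centered_gaussian (W h) (L2norm2 T h)) /\
  (forall h g (a b : R), sq_int T h -> sq_int T g ->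
     {ae P, forall w, W (fun z => a * h z + b * g z) w = a * W h w + b * W g w}).

Definition sheet (W : (R * R -> R) -> Omega -> R) (t x : R) : Omega -> R :=
  W (\1_(`[0, t] `*` `[0, x]) : R * R -> R).

Definition nat_filtration (W : (R * R -> R) -> Omega -> R) (t : R) : set (set Omega) :=
  <<s [set E | (exists s x (A : set R), [/\ 0 <= s <= t, 0 <= x <= 1,
                     measurable A & E = sheet W s x @^-1` A])
               \/ negligible P E] >>.

Definition stoch_conv (W : (R * R -> R) -> Omega -> R) (z : R * R) : Omega -> R :=
  W (fun p : R * R => if p.1 < z.1 then Green (z.1 - p.1) z.2 p.2 else 0).

Definition random_field (U : Omega -> R * R -> R) : Prop :=
  forall z, measurable_fun setT (fun w => U w z).

End Prob.

Definition bounded_continuous_on_C (T : R) (F : (R * R -> R) -> R) : Prop :=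
  (exists M : R, forall f, {within stdom T, continuous f} -> `|F f| <= M) /\
  (forall f, {within stdom T, continuous f} ->
     forall e : R, 0 < e -> exists2 del : R, 0 < del &
       forall g, {within stdom T, continuous g} ->
         (forall z, stdom T z -> `|f z - g z| < del) -> `|F f - F g| < e).

Definition conv_law (T : R)
  (dn : nat -> measure_display) (Om : forall n, measurableType (dn n))
  (Pn : forall n, probability (Om n) R) (Xn : forall n, Om n -> R * R -> R)
  {d' : measure_display} {Om' : measurableType d'} (P' : probability Om' R)
  (X : Om' -> R * R -> R) : Prop :=
  forall F, bounded_continuous_on_C T F ->
    (fun n => \int[Pn n]_w F (Xn n w)) @ \oo --> \int[P']_w F (X w).

End Defs.

(* Main.v *)
Require Import Defs.
From HB Require Import structures.
From mathcomp Require Import all_boot all_order all_algebra.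
From mathcomp Require Import all_classical all_reals all_analysis.
From mathcomp Require Import measurable_realfun.
From mathcomp Require Import ring lra.
Import Order.TTheory GRing.Theory Num.Theory.
Import numFieldNormedType.Exports.
Local Open Scope classical_set_scope.
Local Open Scope ring_scope.
Import HBNNSimple.

(** Put [A v := v - heat_conv (b \o v) - heat_sg u0], so that [v] is the mild
    solution driven by the convolved noise [f] exactly when [A v = f]; thus
    [U_n] solves [A (U_n) = X_n] and [U] solves [A U = X].  Termwise
    integration of the series of the Green function against a weight
    [exp (- lambda t)] bounds the weighted norm of the heat convolution by
    [sum_k 2 / (k^2 + lambda)], which is small for large [lambda].  Hence on
    continuous functions [A] and its inverse are both Lipschitz for the sup
    norm, and the range of [A] is closed for uniform convergence.  For a bounded
    continuous functional [F], Tietze's theorem extends [F \o A^-1] to a bounded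
    continuous functional [Psi] of all functions, so [E F(U_n) = E Psi(X_n)]
    converges to [E Psi(X) = E F(U)].  Working with a closed range avoids
    proving that mild solutions exist and that the heat semigroup and heat
    convolution are continuous. *)

(** * Integrals of functions equal almost everywhere *)

(* Unlike [ae_eq_integral], this needs no measurability: a simple function below
   [f] stays below [g], with the same integral, once it is set to zero on a null
   set containing the points where [f] and [g] differ. *)
Lemma eq_integral_ae d (T : measurableType d) (R : realType)
    (mu : {measure set T -> \bar R}) (f g : T -> \bar R) :
  {ae mu, forall x, f x = g x} ->
  (\int[mu]_x f x = \int[mu]_x g x)%E.
Proof.
suff le_nn (f1 g1 : T -> \bar R) : (forall x, 0 <= f1 x)%E ->
    (forall x, 0 <= g1 x)%E -> {ae mu, forall x, f1 x = g1 x} ->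
    (\int[mu]_x f1 x <= \int[mu]_x g1 x)%E.
  have eq_nn (f1 g1 : T -> \bar R) : (forall x, 0 <= f1 x)%E ->
      (forall x, 0 <= g1 x)%E -> {ae mu, forall x, f1 x = g1 x} ->
      (\int[mu]_x f1 x = \int[mu]_x g1 x)%E.
    move=> f0 g0 fg; apply/eqP; rewrite eq_le !le_nn//.
    by apply: filterS fg => x ->.
  move=> fg; rewrite integralE [RHS]integralE; congr (_ - _)%E.
  - by apply: eq_nn => //; apply: filterS fg => x; rewrite !funeposE => ->.
  - by apply: eq_nn => //; apply: filterS fg => x; rewrite !funenegE => ->.
move=> f0 g0 [N [mN muN0 subN]].
rewrite ge0_integralTE// [X in (_ <= X)%E]ge0_integralTE//.
apply: ge_ereal_sup => /= _ [h hf <-].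
pose h' : {nnsfun T >-> R} := proj_nnsfun h (measurableC mN).
have -> : sintegral mu h = sintegral mu h'.
  rewrite -!integralT_nnsfun.
  apply: (@ae_eq_integral _ _ _ mu setT (EFin \o h')) => //.
  - exact/measurable_EFinP.
  - exact/measurable_EFinP.
  - exists N; split => // x /= hx; apply: contrapT => nNx; apply: hx => _.
    by rewrite /= mindicE mem_set//= mulr1.
apply: ereal_sup_ubound; exists h' => //= x; rewrite mindicE.
case: (boolP (x \in ~` N)) => xN; last by rewrite mulr0.
rewrite mulr1 (le_trans (hf x))// (_ : f1 x = g1 x)//.
apply: contrapT => fgx.
by move: xN; rewrite in_setC => /negP; apply; rewrite inE; exact: subN.
Qed.

Lemma eq_Rintegral_ae d (T : measurableType d) (R : realType)
    (mu : {measure set T -> \bar R}) (f g : T -> R) :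
  {ae mu, forall x, f x = g x} -> \int[mu]_x f x = \int[mu]_x g x.
Proof.
move=> fg; rewrite /Rintegral; congr fine; apply: eq_integral_ae.
by apply: filterS fg => x ->.
Qed.

(** * Continuous functions on the space-time rectangle *)

(** Each point of an open superlevel set lies in a box with rational corners contained in that set.
    The set is thus a countable union of boxes, hence measurable for the product sigma-algebra. *)
Lemma continuous_measurable_fun2 (R : realType) (f : R * R -> R) :
  continuous f -> measurable_fun [set: R * R] f.
Proof.
move=> cf.
apply: (measurability _ (RGenOInfty.measurableE R)) => _ [_ [a ->] <-].
rewrite setTI.
pose box (q : (rat * rat) * (rat * rat)) : set (R * R) :=
  `]ratr q.1.1, ratr q.1.2[ `*` `]ratr q.2.1, ratr q.2.2[.
pose W := f @^-1` `]a, +oo[.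
rewrite (_ : _ @^-1` _ =
    \bigcup_q (if `[< box q `<=` W >] then box q else set0)); last first.
  apply/seteqP; split => [[s y] /= Wsy|z [q _]]; last first.
    by case: asboolP => // /[apply].
  have /cf : nbhs (f (s, y)) [set` `]a, +oo[].
    by apply: open_nbhs_nbhs; split => //; exact: interval_open.
  rewrite -[nbhs _ _]/(nbhs (s, y) W) -nbhs_ballE => -[e /= e0 eW].
  have rb (z : R) : exists q : rat * rat,
      [/\ z - e < ratr q.1, ratr q.1 < z, z < ratr q.2 & ratr q.2 < z + e].
    have [|q1] := @rat_in_itvoo R (z - e) z; first by rewrite gtrBl.
    have [|q2] := @rat_in_itvoo R z (z + e); first by rewrite ltrDl.
    by rewrite !in_itv/= => /andP[? ?] /andP[? ?]; exists (q1, q2).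
  have [q1 [? ? ? ?]] := rb s; have [q2 [? ? ? ?]] := rb y.
  exists (q1, q2) => //; case: asboolP; last first.
    case => -[s' y'] [/=]; rewrite !in_itv/= => /andP[? ?] /andP[? ?].
    apply: eW; split => /=; rewrite /ball/= ltr_norml; apply/andP; split; lra.
  by move=> _; split => /=; rewrite in_itv/=; apply/andP.
apply: countable_bigcupT_measurable; first exact: countableP.
move=> q; case: ifP => // _; apply: measurableX => //; exact: measurable_itv.
Qed.

Section clamp.
Context {R : realType} (T : R).
Hypothesis T0 : 0 < T.

Let clamp (z : R * R) : R * R :=
  (Num.max 0 (Num.min T z.1), Num.max 0 (Num.min 1 z.2)).

Let clamp_stdom z : stdom T (clamp z).
Proof.
split; rewrite /= in_itv/= le_max lexx/= ge_max ?(ltW T0) ?ler01 ge_min lexx//.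
Qed.

Let clamp_id z : stdom T z -> clamp z = z.
Proof.
case: z => s y [/=]; rewrite !in_itv/= => /andP[s0 sT] /andP[y0 y1].
by rewrite /clamp/= !min_r// !max_r.
Qed.

Let continuous_clamp : continuous clamp.
Proof.
have c1 : continuous (fun z : R * R => Num.max 0 (Num.min T z.1)).
  move=> z; apply: (@continuous_max _ _ (cst 0) (fun z : R * R => Num.min T z.1)).
    exact: cvg_cst.
  by apply: (@continuous_min _ _ (cst T) fst); [exact: cvg_cst|exact: cvg_fst].
have c2 : continuous (fun z : R * R => Num.max 0 (Num.min 1 z.2)).
  move=> z; apply: (@continuous_max _ _ (cst 0) (fun z : R * R => Num.min 1 z.2)).
    exact: cvg_cst.
  by apply: (@continuous_min _ _ (cst (1 : R)) snd); [exact: cvg_cst|exact: cvg_snd].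
by move=> z; exact: (cvg_pair (c1 z) (c2 z)).
Qed.

(** Precomposing with [clamp], a continuous retraction of the plane onto the rectangle, gives the
    extension. *)
Lemma within_stdom_continuous_extension (v : R * R -> R) :
  {within stdom T, continuous v} ->
  exists2 v' : R * R -> R, continuous v' & forall z, stdom T z -> v' z = v z.
Proof.
move=> /subspace_continuousP cv; exists (v \o clamp).
  move=> z; apply: cvg_trans (cv _ (clamp_stdom z)) => P /= nP.
  have nP' : nbhs (clamp z) [set w | stdom T w -> P (v w)] by [].
  have nP2 : nbhs z [set w | stdom T (clamp w) -> P (v (clamp w))].
    exact: (@continuous_clamp z _ nP').
  suff : nbhs z [set w | P (v (clamp w))] by [].
  by apply: filterS nP2 => w; apply; exact: clamp_stdom.
by move=> z zT; rewrite /= clamp_id.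
Qed.

Lemma within_stdom_measurable (v : R * R -> R) :
  {within stdom T, continuous v} -> measurable_fun (stdom T) v.
Proof.
move=> /within_stdom_continuous_extension[v' cv' vv'].
apply: (eq_measurable_fun v'); first by move=> z /set_mem; exact: vv'.
by apply: measurable_funTS; exact: continuous_measurable_fun2.
Qed.

End clamp.

Lemma within_stdom_bounded (R : realType) (T : R) (v : R * R -> R) :
  {within stdom T, continuous v} ->
  exists2 M : R, 0 <= M & forall z, stdom T z -> `|v z| <= M.
Proof.
move=> cv.
have /compact_bounded[M [_ bM]] : compact (v @` stdom T).
  apply: continuous_compact cv _.
  by apply: compact_setX; exact: segment_compact.
exists (Num.max 0 (M + 1)); first by rewrite le_max lexx.
move=> z zT; rewrite le_max; apply/orP; right.
by apply: (bM (M + 1)); [rewrite ltrDl|exists z].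
Qed.

(** * Elementary bounds for the weighted series *)

(** The sum is compared with a telescoping one: [(k + m) (k + m + 1) <= (k + (m + 1))^2 <= 2 (k^2 +
    (m + 1)^2)], so the term of index [k] is at most [2 / (k + m) - 2 / (k + 1 + m)]. *)
Lemma sum_inv_sq_le (R : realType) (m : R) (n : nat) : 0 < m ->
  \sum_(0 <= k < n) (k%:R ^+ 2 + (m + 1) ^+ 2)^-1 <= 2 / m.
Proof.
move=> m0; have p j : 0 < j%:R + m by rewrite ltr_wpDl.
suff : \sum_(0 <= k < n) (k%:R ^+ 2 + (m + 1) ^+ 2)^-1 <= 2 / m - 2 / (n%:R + m).
  by move=> /le_trans; apply; rewrite gerBl divr_ge0// ltW.
elim: n => [|n ih]; first by rewrite big_nil add0r subrr.
rewrite big_nat_recr//= (le_trans (lerD ih (lexx _)))//.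
have step : (n%:R ^+ 2 + (m + 1) ^+ 2)^-1 <= 2 / (n%:R + m) - 2 / (n.+1%:R + m).
  have -> : 2 / (n%:R + m) - 2 / (n.+1%:R + m)
      = ((n%:R + m) * (n%:R + m + 1) / 2)^-1.
    have := p n; have := p n.+1; rewrite -natr1 => h1 h2.
    by field; rewrite !gt_eqF//=; lra.
  have nm := p n; rewrite lef_pV2 ?posrE.
  - have := sqr_ge0 (n%:R - (m + 1)); nra.
  - by rewrite ltr_wpDl ?sqr_ge0// exprn_gt0// ltr_wpDr.
  - by rewrite divr_gt0// mulr_gt0// ltr_wpDr.
by move: step; lra.
Qed.

Lemma integral_expR_le (R : realType) (c t : R) : 0 < c -> 0 <= t ->
  (\int[lebesgue_measure]_(s in `[0%R, t]) (expR (- (c * (t - s))))%:E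
    <= (c^-1)%:E)%E.
Proof.
(* The degenerate interval [t = 0] is treated apart, since the fundamental theorem of calculus is
   applied on a proper interval. *)
move=> c0; rewrite le_eqVlt => /predU1P[<-|t0].
  by rewrite set_itv1 integral_set1 lee_fin invr_ge0 ltW.
have dF (s : R) : is_derive s 1 (fun s => c^-1 * expR (- (c * (t - s))))
    (expR (- (c * (t - s)))).
  by apply: is_derive_eq; rewrite /GRing.scale/=; field; rewrite gt_eqF.
have cont (f f' : R -> R) : (forall s : R, is_derive s (1 : R) f (f' s)) -> continuous f.
  move=> df s; apply: differentiable_continuous.
  by apply/derivable1_diffP; case: (df s).
rewrite (@continuous_FTC2 _ _ (fun s => c^-1 * expR (- (c * (t - s)))))//.
- rewrite subrr mulr0 oppr0 expR0 mulr1 -EFinB lee_fin gerBl.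
  by rewrite mulr_ge0 ?invr_ge0 ?expR_ge0// ltW.
- by apply: continuous_subspaceT; exact: cont.
- split.
  + by move=> s _; case: (dF s).
  + exact/cvg_at_right_filter/(cont _ _ dF).
  + exact/cvg_at_left_filter/(cont _ _ dF).
- by move=> s _; rewrite derive1E; apply: derive_val.
Qed.

(** * Convergence, bounds and measurability of the Green function *)

Section green.
Context {R : realType}.
Implicit Types (m r x y : R).

(** This is [exp (- lambda r) * sum_k exp (- k^2 r)] with [lambda = (m + 1)^2]: a majorant of the
    heat kernel with the time weight built in. Extended real values allow [r = 0], where the sum is
    infinite. *)
Definition green_bound m r : \bar R :=
  (\sum_(0 <= k <oo) (expR (- ((k%:R ^+ 2 + (m + 1) ^+ 2) * r)))%:E)%E.

Lemma green_bound_ge0 m r : (0 <= green_bound m r)%E.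
Proof. by apply: nneseries_ge0 => k _ _; rewrite lee_fin expR_ge0. Qed.

Lemma measurable_green_bound m (t : R) :
  measurable_fun setT (fun s : R => green_bound m (t - s)).
Proof.
apply: ge0_emeasurable_sum => [k s _ _|k _]; first by rewrite lee_fin expR_ge0.
apply/measurable_EFinP; apply: measurableT_comp => //.
apply: measurableT_comp => //; apply: measurable_funM => //.
exact: measurable_funB.
Qed.

(** Integrating termwise leaves [sum_k 1 / (k^2 + (m + 1)^2)]. This is the source of all smallness
    for large [m]. *)
Lemma integral_green_bound m t : 0 < m -> 0 <= t ->
  (\int[lebesgue_measure]_(s in `[0%R, t]) green_bound m (t - s) <= (2 / m)%:E)%E.
Proof.
move=> m0 t0; rewrite integral_nneseries//.
- apply: lime_le.
    by apply: is_cvg_nneseries => k _ _; apply: integral_ge0 => s _; rewrite lee_fin expR_ge0.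
  apply: nearW => n.
  apply: (@le_trans _ _ (\sum_(0 <= k < n) ((k%:R ^+ 2 + (m + 1) ^+ 2)^-1)%:E)%E).
    apply: lee_sum => k _; apply: integral_expR_le => //.
    by rewrite ltr_wpDl ?sqr_ge0// exprn_gt0// ltr_wpDr.
  by rewrite sumEFin lee_fin sum_inv_sq_le.
- move=> k; apply/measurable_EFinP; apply: measurable_funTS; apply: measurableT_comp => //.
  apply: measurableT_comp => //; apply: measurable_funM => //.
  exact: measurable_funB.
Qed.

Let green_term r x y (k : nat) : R := sin (k%:R * pi * x) * sin (k%:R * pi * y)
       * expR (- (k%:R ^+ 2 * pi ^+ 2 * r)).

(** The term of index 0 vanishes because [sin 0 = 0], so starting at 0 or at 1 is the same. *)
Let green_sumE r x y (n : nat) :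
  \sum_(1 <= k < n) green_term r x y k = series (green_term r x y) n.
Proof.
rewrite /series/=; case: n => [|n]; first by rewrite !big_geq.
by rewrite [RHS]big_ltn// /green_term !mul0r sin0 !mul0r add0r.
Qed.

Let green_term_le r x y k : 0 <= r ->
  `|green_term r x y k| <= expR (- (k%:R ^+ 2 * r)).
Proof.
move=> r0; rewrite !normrM (ger0_norm (expR_ge0 _)) -[leRHS]mul1r.
rewrite ler_pM ?mulr_ge0//.
  apply: (@le_trans _ _ (1 * 1)); last by rewrite mul1r.
  by apply: ler_pM => //; rewrite ler_norml sin_geN1 sin_le1.
rewrite ler_expR lerN2 ler_wpM2r// ler_peMr ?sqr_ge0//.
by rewrite exprn_ege1// (le_trans _ (pi_ge2 R))// ler1n.
Qed.

Let green_term_cvg r x y : 0 < r -> cvgn (series (green_term r x y)).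
Proof.
move=> r0; apply: normed_cvg.
apply: (@series_le_cvg _ _ (geometric 1 (expR (- r)))) => //.
- by move=> k; exact: normr_ge0.
- by move=> k; apply: geometric_ge0 => //; exact: expR_ge0.
- move=> k /=. apply: le_trans (green_term_le r x y k (ltW r0)) _.
  (* Since [k <= k^2], the terms are dominated by a geometric series of ratio [exp (- r)]. *)
  have kk : k%:R <= k%:R ^+ 2 :> R.
    by rewrite -natrX ler_nat -mulnn; case: (k) => // j; rewrite leq_pmull.
  by rewrite mul1r -expRM_natl ler_expR mulrN lerN2 ler_wpM2r// ltW.
- by apply: is_cvg_geometric_series; rewrite ger0_norm ?expR_ge0// expR_lt1 oppr_lt0.
Qed.

(** [Green] is given by the total function [limn]; only actual convergence lets bounds and
    measurability pass from the partial sums to it. *)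
Lemma Green_partial_sums r x y : 0 < r ->
  2 * (\sum_(1 <= k < n) (sin (k%:R * pi * x) * sin (k%:R * pi * y)
       * expR (- (k%:R ^+ 2 * pi ^+ 2 * r)))) @[n --> \oo] --> Green r x y.
Proof.
move=> r0; apply: cvgM; first exact: cvg_cst.
have := green_term_cvg r x y r0.
by rewrite (_ : series _ = fun n => \sum_(1 <= k < n) green_term r x y k)//; apply/funext => n.
Qed.

(** Each term satisfies [exp (- k^2 r) = exp (lambda r) * exp (- (k^2 + lambda) r)] with
    [lambda = (m + 1)^2]; the first factor leaves the sum. *)
Lemma Green_le m r x y : 0 < r ->
  (`|Green r x y|%:E <= (2 * expR ((m + 1) ^+ 2 * r))%:E * green_bound m r)%E.
Proof.
move=> r0; have := green_bound_ge0 m r.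
have : forall n, (\sum_(0 <= k < n) (expR (- ((k%:R ^+ 2 + (m + 1) ^+ 2) * r)))%:E
    <= green_bound m r)%E.
  by move=> n; apply: nneseries_lim_ge => k _ _; rewrite lee_fin expR_ge0.
case: (green_bound m r) => // [g gn g0|_ _]; last first.
  by rewrite gt0_muley ?leey// lte_fin mulr_gt0// expR_gt0.
rewrite -EFinM lee_fin.
have /cvg_norm/(cvgr_to_le) := @Green_partial_sums r x y r0.
apply; apply: nearW => n.
rewrite (green_sumE r x y) normrM ger0_norm// -mulrA ler_wpM2l//.
apply: (@le_trans _ _ (\sum_(0 <= k < n) expR (- (k%:R ^+ 2 * r)))).
  apply: (le_trans (ler_norm_sum _ _ _)).
  by apply: ler_sum => k _; apply: green_term_le; exact: ltW.
have := gn n; rewrite sumEFin lee_fin => /(ler_wpM2l (expR_ge0 ((m + 1) ^+ 2 * r))).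
move/(le_trans _); apply; rewrite mulr_sumr; apply: ler_sum => k _.
by rewrite -expRD ler_expR; lra.
Qed.

Lemma measurable_Green (t x : R) :
  measurable_fun [set z : R * R | z.1 < t] (fun z => Green (t - z.1) x z.2).
Proof.
have mS (n : nat) : measurable_fun [set z : R * R | z.1 < t]
    (fun z : R * R => 2 * (\sum_(1 <= k < n) (sin (k%:R * pi * x) *
       sin (k%:R * pi * z.2) * expR (- (k%:R ^+ 2 * pi ^+ 2 * (t - z.1)))))).
  apply: measurable_funTS; apply: measurable_funM => //.
  apply: measurable_sum => k; apply: measurable_funM.
    apply: measurable_funM => //.
    apply: (@measurableT_comp _ _ _ _ _ _ (@sin R)).
      by apply: continuous_measurable_fun; exact: continuous_sin.
    exact: measurable_funM.
  apply: measurableT_comp => //; apply: measurableT_comp => //.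
  by apply: measurable_funM => //; exact: measurable_funB.
apply: (measurable_fun_cvg mS) => z /= zt.
by apply: Green_partial_sums; rewrite subr_gt0.
Qed.

End green.

(** From [1 + x <= exp x] follows [exp (- c r) <= 1 / (c r)], which reduces the claim to
    [sum_inv_sq_le]. *)
Lemma green_bound_lty (R : realType) (m r : R) : 0 < m -> 0 < r ->
  (green_bound m r < +oo)%E.
Proof.
move=> m0 r0; apply: (@le_lt_trans _ _ (r^-1 * (2 / m))%:E); last exact: ltry.
apply: lime_le.
  by apply: is_cvg_nneseries => k _ _; rewrite lee_fin expR_ge0.
apply: nearW => n; rewrite sumEFin lee_fin.
apply: (@le_trans _ _ (r^-1 * \sum_(0 <= k < n) (k%:R ^+ 2 + (m + 1) ^+ 2)^-1)); last first.
  by apply: ler_wpM2l; [rewrite invr_ge0 ltW|exact: sum_inv_sq_le].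
rewrite mulr_sumr; apply: ler_sum => k _.
have c0 : 0 < k%:R ^+ 2 + (m + 1) ^+ 2.
  by rewrite ltr_wpDl ?sqr_ge0// exprn_gt0// ltr_wpDr.
rewrite -invfM expRN lef_pV2 ?posrE ?expR_gt0 ?mulr_gt0//.
by rewrite mulrC (le_trans _ (expR_ge1Dx _))// lerDr.
Qed.

Lemma Green_le_fine (R : realType) (m r x y : R) : 0 < m -> 0 < r ->
  `|Green r x y| <= 2 * expR ((m + 1) ^+ 2 * r) * fine (green_bound m r).
Proof.
move=> m0 r0; have := Green_le m r x y r0.
have gfin : green_bound m r \is a fin_num.
  by rewrite ge0_fin_numE ?green_bound_ge0// green_bound_lty.
by rewrite -{1}(fineK gfin) -EFinM lee_fin.
Qed.

(** * Weighted estimate for the heat convolution *)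

Section heat_conv_estimate.
Context {R : realType} (T t x : R).
Hypothesis tT : 0 <= t <= T.
Local Notation mu := (@lebesgue_measure R).

(** The time variable will range over [[0, t[]: the bounds on [Green] require a positive time lag
    [t - s]. *)
Let inner (h : R * R -> R) (s : R) : R :=
  \int[mu]_(y in `[0, 1]) (Green (t - s) x y * h (s, y)).

Let stdomP (s y : R) : s \in `[0, t[ -> y \in `[0, 1] -> stdom T (s, y).
Proof.
rewrite in_itv/= => /andP[s0 st] yI; split => //=; rewrite in_itv/= s0/=.
by case/andP: tT => _; apply: le_trans; exact: ltW.
Qed.

Let measurable_integrand (h : R * R -> R) : measurable_fun (stdom T) h ->
  measurable_fun (`[0, t[%classic `*` `[0, 1]%classic : set (R * R)) (fun z : R * R => Green (t - z.1) x z.2 * h z).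
Proof.
move=> mh; have mD : measurable (`[0, t[%classic `*` `[0, 1]%classic : set (R * R)).
  by apply: measurableX; exact: measurable_itv.
apply: measurable_funM.
  apply: (measurable_funS _ _ (measurable_Green t x)).
    rewrite (_ : [set z | _] = `]-oo, t[%classic `*` setT); last first.
      by apply/seteqP; split => z /=; rewrite in_itv/=; [|case].
    by apply: measurableX => //; exact: measurable_itv.
  by move=> z [/=]; rewrite in_itv/= => /andP[].
apply: (measurable_funS _ _ mh).
  by apply: measurableX; exact: measurable_itv.
by move=> [s y] [? ?]; exact: stdomP.
Qed.

Let measurable_integrand1 (h : R * R -> R) s : measurable_fun (stdom T) h ->
  s \in `[0, t[ -> measurable_fun (`[0, 1]%classic : set R) (fun y : R => Green (t - s) x y * h (s, y)).
Proof.
move=> mh sI.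
have mD : measurable (`[0, t[%classic `*` `[0, 1]%classic : set (R * R)).
  by apply: measurableX; exact: measurable_itv.
have sub : pair s @` `[0, 1]%classic `<=` (`[0, t[%classic `*` `[0, 1]%classic : set (R * R)).
  by move=> _ [y yI <-]; split.
have mp : measurable_fun (`[0, 1]%classic : set R) (pair s : R -> R * R).
  by apply: measurable_funTS; exact: pair1_measurable.
exact: (measurable_comp mD sub (measurable_integrand h mh) mp).
Qed.

Let integrand_le (h : R * R -> R) (m D : R) s y : 0 < m ->
  (forall z, stdom T z -> `|h z| <= D * expR ((m + 1) ^+ 2 * z.1)) ->
  s \in `[0, t[ -> y \in `[0, 1] ->
  `|Green (t - s) x y * h (s, y)|
    <= 2 * D * expR ((m + 1) ^+ 2 * t) * fine (green_bound m (t - s)).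
Proof.
move=> m0 hD sI yI.
have r0 : 0 < t - s by move: sI; rewrite in_itv/= subr_gt0 => /andP[].
rewrite normrM.
apply: (le_trans (ler_pM _ _ (Green_le_fine _ m _ x y m0 r0) (hD _ (stdomP _ _ sI yI)))) => //=.
(* The weight at [t] factors into the weight over the lag [t - s], from the kernel bound, and the
   weight at [s], from the bound on [h]. *)
rewrite (_ : (m + 1) ^+ 2 * t = (m + 1) ^+ 2 * (t - s) + (m + 1) ^+ 2 * s); last by ring.
by rewrite expRD le_eqVlt; apply/orP; left; apply/eqP; ring.
Qed.

Let integrable_integrand (h : R * R -> R) (m D : R) s :
  measurable_fun (stdom T) h -> 0 < m ->
  (forall z, stdom T z -> `|h z| <= D * expR ((m + 1) ^+ 2 * z.1)) ->
  s \in `[0, t[ ->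
  mu.-integrable `[0, 1] (EFin \o (fun y : R => Green (t - s) x y * h (s, y))).
Proof.
move=> mh m0 hD sI; apply: measurable_bounded_integrable => //.
- by rewrite /= lebesgue_measure_itv/= lte_fin ltr01 -EFinB ltry.
- exact: measurable_integrand1.
- exists (2 * D * expR ((m + 1) ^+ 2 * t) * fine (green_bound m (t - s))).
  split; first exact: num_real.
  move=> M /ltW DM y /= yI; apply: le_trans DM.
  exact: integrand_le.
Qed.

Let inner_le (h : R * R -> R) (m D : R) s :
  measurable_fun (stdom T) h -> 0 < m ->
  (forall z, stdom T z -> `|h z| <= D * expR ((m + 1) ^+ 2 * z.1)) ->
  s \in `[0, t[ ->
  `|inner h s| <= 2 * D * expR ((m + 1) ^+ 2 * t) * fine (green_bound m (t - s)).
Proof.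
move=> mh m0 hD sI.
have ih := integrable_integrand h m D s mh m0 hD sI.
set c := (X in _ <= X).
have c_int : \int[mu]_(y in `[0, 1]) c = c.
  by rewrite Rintegral_cst//= lebesgue_measure_itv/= lte_fin ltr01 -EFinB/= subr0 mulr1.
rewrite -c_int /inner; apply: (le_trans (le_normr_Rintegral _ ih)) => //.
apply: le_Rintegral => //.
- exact: integrable_norm ih.
- apply: measurable_bounded_integrable => //.
  + by rewrite /= lebesgue_measure_itv/= lte_fin ltr01 -EFinB ltry.
  + exists `|c|; split; first exact: num_real.
    by move=> M /ltW cM y _ /=.
- by move=> y yI; exact: integrand_le.
Qed.

Let measurable_inner (h : R * R -> R) : measurable_fun (stdom T) h ->
  measurable_fun (`[0, t[%classic : set R) (inner h).
Proof.
move=> mh.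
pose f := (fun z : R * R => (Green (t - z.1) x z.2 * h z)%:E)
            \_ (`[0, t[%classic `*` `[0, 1]%classic).
have mf : measurable_fun setT f.
  have mD : measurable (`[0, t[%classic `*` `[0, 1]%classic : set (R * R)).
    by apply: measurableX; exact: measurable_itv.
  apply: (measurable_restrictT _ mD).1.
  by apply/measurable_EFinP; exact: measurable_integrand.
have mF : measurable_fun setT (fun s => \int[mu]_y f (s, y))%E.
  (* Splitting into positive and negative parts allows Tonelli's theorem, which asks for no joint
     integrability. *)
  rewrite (_ : (fun s => _) = (fun s => \int[mu]_y (f^\+ (s, y))%E)
                           \- (fun s => \int[mu]_y (f^\- (s, y))%E))%E; last first.
    apply/funext => s; rewrite [LHS]integralE.
    by congr (_ - _)%E; apply: eq_integral => y _; rewrite ?funeposE ?funenegE.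
  apply: emeasurable_funB.
    apply: (measurable_fun_fubini_tonelli_F (m2 := mu) (f^\+)%E) => //.
    exact: measurable_funepos.
  apply: (measurable_fun_fubini_tonelli_F (m2 := mu) (f^\-)%E) => //.
  exact: measurable_funeneg.
apply: (eq_measurable_fun (fine \o (fun s => \int[mu]_y f (s, y))%E)); last first.
  by apply: measurable_funTS; exact: measurableT_comp.
move=> s /set_mem /= sI; rewrite /inner /Rintegral; congr fine.
rewrite [RHS]integral_mkcond; apply: eq_integral => y _.
by rewrite /f !patchE in_setX mem_set.
Qed.

Let integral_inner_le (h : R * R -> R) (m D : R) :
  measurable_fun (stdom T) h -> 0 < m -> 0 <= D ->
  (forall z, stdom T z -> `|h z| <= D * expR ((m + 1) ^+ 2 * z.1)) ->
  (\int[mu]_(s in `[0%R, t[) `|inner h s|%:E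
     <= (4 * D * expR ((m + 1) ^+ 2 * t) / m)%:E)%E.
Proof.
move=> mh m0 D0 hD; case/andP: (tT) => t0 _.
set c := 2 * D * expR ((m + 1) ^+ 2 * t).
have c0 : 0 <= c by rewrite !mulr_ge0// expR_ge0.
apply: (@le_trans _ _ (\int[mu]_(s in `[0%R, t[) (c%:E * green_bound m (t - s)))%E).
  apply: ge0_le_integral => //.
  - apply/measurable_EFinP; apply: measurableT_comp => //.
    exact: measurable_inner.
  - apply: measurable_funTS; apply: emeasurable_funM => //.
    exact: measurable_green_bound.
  - move=> s sI; have r0 : 0 < t - s.
      by move: sI; rewrite /= in_itv/= subr_gt0 => /andP[].
    have gfin : green_bound m (t - s) \is a fin_num.
      by rewrite ge0_fin_numE ?green_bound_ge0// green_bound_lty.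
    by rewrite -(fineK gfin) -EFinM lee_fin; exact: inner_le.
rewrite ge0_integralZl//; last 2 first.
- by apply: measurable_funTS; exact: measurable_green_bound.
- by move=> s _; exact: green_bound_ge0.
(* The 4 is the 2 in front of the Green series times the 2 of [integral_green_bound]. *)
rewrite (_ : 4 * D * _ / m = c * (2 / m)); last by rewrite /c; ring.
rewrite [leRHS]EFinM; apply: lee_wpmul2l => //.
apply: le_trans (integral_green_bound m t m0 t0).
apply: ge0_subset_integral => //.
- by apply: measurable_funTS; exact: measurable_green_bound.
- by move=> s _; exact: green_bound_ge0.
- by move=> s /=; rewrite !in_itv/= => /andP[-> /ltW].
Qed.

Let integrable_inner (h : R * R -> R) (m D : R) :
  measurable_fun (stdom T) h -> 0 < m -> 0 <= D ->
  (forall z, stdom T z -> `|h z| <= D * expR ((m + 1) ^+ 2 * z.1)) ->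
  mu.-integrable `[0, t[ (EFin \o inner h).
Proof.
move=> mh m0 D0 hD; apply/integrableP; split.
  by apply/measurable_EFinP; exact: measurable_inner.
exact: le_lt_trans (integral_inner_le _ _ _ mh m0 D0 hD) (ltry _).
Qed.

(** The bound [M] only serves to make both convolutions integrable, so that their difference is the
    convolution of [h1 - h2]; the estimate itself sees only [D]. *)
Lemma heat_convB_le (h1 h2 : R * R -> R) (m D M : R) :
  measurable_fun (stdom T) h1 -> measurable_fun (stdom T) h2 ->
  (forall z, stdom T z -> `|h1 z| <= M) ->
  (forall z, stdom T z -> `|h2 z| <= M) ->
  0 < m -> 0 <= D ->
  (forall z, stdom T z -> `|h1 z - h2 z| <= D * expR ((m + 1) ^+ 2 * z.1)) ->
  `|heat_conv h1 t x - heat_conv h2 t x|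
    <= 4 * D * expR ((m + 1) ^+ 2 * t) / m.
Proof.
move=> mh1 mh2 h1M h2M m0 D0 h12.
(* The weight is at least 1 at nonnegative times, so a uniform bound is also a weighted one. *)
have w (h : R * R -> R) : (forall z, stdom T z -> `|h z| <= M) -> forall z, stdom T z ->
    `|h z| <= `|M| * expR ((m + 1) ^+ 2 * z.1).
  move=> hM z zT; rewrite (le_trans (hM z zT))// (le_trans (ler_norm M))//.
  rewrite ler_peMr// -expR0 ler_expR mulr_ge0 ?sqr_ge0//.
  by case: zT => /=; rewrite in_itv/= => /andP[].
have M0 := normr_ge0 M.
have i1 := integrable_inner _ _ _ mh1 m0 M0 (w _ h1M).
have i2 := integrable_inner _ _ _ mh2 m0 M0 (w _ h2M).
have mh := measurable_funB mh1 mh2.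
have ib := integrable_inner (h1 \- h2) _ _ mh m0 D0 h12.
have hcE (h : R * R -> R) : mu.-integrable `[0, t[ (EFin \o inner h) ->
    heat_conv h t x = \int[mu]_(s in `[0, t[) inner h s.
  (* Removing the endpoint [s = t] does not change the integral. *)
  by move=> ih; rewrite (Rintegral_itv_bndo_bndc ih).
rewrite (hcE h1)// (hcE h2)// -RintegralB//.
rewrite (_ : \int[mu]_(s in _) _ = \int[mu]_(s in `[0, t[) inner (h1 \- h2) s); last first.
  apply: eq_Rintegral.
  move=> s /set_mem /= sI; rewrite /inner -RintegralB//.
  - by apply: eq_Rintegral => y _; rewrite mulrBr.
  - exact: integrable_integrand m0 (w _ h1M) sI.
  - exact: integrable_integrand m0 (w _ h2M) sI.
apply: (le_trans (le_normr_Rintegral _ ib)) => //.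
rewrite /Rintegral -lee_fin fineK.
  exact: integral_inner_le.
by apply: integrable_fin_num => //; exact: integrable_norm ib.
Qed.

End heat_conv_estimate.

(** * Lipschitz bounds for [noise_of] and its inverse *)

Section solution_map.
Context {R : realType} (T L : R) (u0 b : R -> R).
Hypotheses (T0 : 0 < T) (L0 : 0 <= L).
Hypothesis bL : forall x y, `|b x - b y| <= L * `|x - y|.

(* With this weight, [v |-> heat_conv (b \o v)] contracts the norm
   [sup |v (t, x)| expR (- (m + 1) ^+ 2 * t)] by the factor 1/2. *)
Let m := 8 * L + 1.
Let m0 : 0 < m. Proof. by rewrite ltr_wpDl// mulr_ge0. Qed.

(* The convolved noise for which [v] is the mild solution: the map [A] above. *)
Definition noise_of (v : R * R -> R) (z : R * R) : R :=
  v z - heat_conv (b \o v) z.1 z.2 - heat_sg u0 z.1 z.2.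

Lemma within_comp_lipschitz (v : R * R -> R) :
  {within stdom T, continuous v} -> {within stdom T, continuous (b \o v)}.
Proof.
have cb : continuous b.
  move=> x; apply/cvgrPdist_lt => e e0; near=> y.
  rewrite (le_lt_trans (bL x y))//.
  (* [L + 1] replaces [L] in order to divide by a positive number. *)
  apply: (@le_lt_trans _ _ ((L + 1) * `|x - y|)).
    by rewrite ler_wpM2r// lerDl.
  rewrite mulrC -ltr_pdivlMr; last by rewrite ltr_wpDl.
  near: y; apply: cvgr_dist_lt; first exact: cvg_id.
  by rewrite divr_gt0// ltr_wpDl.
move=> /subspace_continuousP cv; apply/subspace_continuousP => z zT.
exact: (cvg_comp _ _ (cv z zT) (cb (v z))).
Unshelve. all: by end_near. Qed.

Lemma heat_conv_lipschitz (v1 v2 : R * R -> R) (D : R) (z : R * R) :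
  {within stdom T, continuous v1} -> {within stdom T, continuous v2} ->
  0 <= D -> stdom T z ->
  (forall z, stdom T z -> `|v1 z - v2 z| <= D * expR ((m + 1) ^+ 2 * z.1)) ->
  `|heat_conv (b \o v1) z.1 z.2 - heat_conv (b \o v2) z.1 z.2|
    <= D / 2 * expR ((m + 1) ^+ 2 * z.1).
Proof.
move=> /within_comp_lipschitz c1 /within_comp_lipschitz c2 D0 zT v12.
have [M1 _ b1] := within_stdom_bounded _ _ _ c1.
have [M2 _ b2] := within_stdom_bounded _ _ _ c2.
have tT : 0 <= z.1 <= T by case: zT => /=; rewrite in_itv.
apply: (le_trans (heat_convB_le T z.1 z.2 tT _ _ m (L * D) (Num.max M1 M2)
  _ _ _ _ m0 _ _)).
- exact: within_stdom_measurable.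
- exact: within_stdom_measurable.
- by move=> w wT; rewrite le_max b1.
- by move=> w wT; rewrite le_max b2// orbT.
- exact: mulr_ge0.
- move=> w wT; apply: (le_trans (bL _ _)).
  by rewrite -mulrA ler_wpM2l// v12.
(* The choice of [m] gives [4 * L / m <= 1 / 2]. *)
rewrite mulrAC ler_wpM2r ?expR_ge0// ler_pdivrMr// /m; nra.
Qed.

Lemma noise_of_lipschitz (v1 v2 : R * R -> R) (d : R) :
  {within stdom T, continuous v1} -> {within stdom T, continuous v2} ->
  0 <= d -> (forall z, stdom T z -> `|v1 z - v2 z| <= d) ->
  forall z, stdom T z ->
  `|noise_of v1 z - noise_of v2 z| <= d * (1 + expR ((m + 1) ^+ 2 * T)).
Proof.
move=> c1 c2 d0 v12 z zT.
have zz : 0 <= z.1 <= T by case: zT => /=; rewrite in_itv.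
have := heat_conv_lipschitz v1 v2 d z c1 c2 d0 zT.
have h w : stdom T w -> `|v1 w - v2 w| <= d * expR ((m + 1) ^+ 2 * w.1).
  move=> wT; rewrite (le_trans (v12 _ wT))// ler_peMr// -expR0 ler_expR.
  by rewrite mulr_ge0 ?sqr_ge0//; case: wT => /=; rewrite in_itv/= => /andP[].
move=> /(_ h); rewrite /noise_of.
have := v12 _ zT.
have : expR ((m + 1) ^+ 2 * z.1) <= expR ((m + 1) ^+ 2 * T).
  by rewrite ler_expR ler_wpM2l ?sqr_ge0//; case/andP: zz.
move=> e1 a1 a2.
have a3 : d / 2 * expR ((m + 1) ^+ 2 * z.1) <= d * expR ((m + 1) ^+ 2 * T).
  have := expR_ge0 ((m + 1) ^+ 2 * z.1); nra.
rewrite [X in `|X|](_ : _ = (v1 z - v2 z)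
  - (heat_conv (b \o v1) z.1 z.2 - heat_conv (b \o v2) z.1 z.2)); last by ring.
by rewrite (le_trans (ler_normB _ _))// mulrDr mulr1 lerD// (le_trans a2).
Qed.

Let K := 2 * expR ((m + 1) ^+ 2 * T).
Let K0 : 0 < K. Proof. by rewrite mulr_gt0// expR_gt0. Qed.

(** The weighted distance [S] of [v1] and [v2] satisfies [S <= d + S / 2] by the contraction, so
    [S <= 2 * d]. Undoing the weight costs at most [expR ((m + 1) ^+ 2 * T)], whence [K]. *)
Lemma noise_of_inv_lipschitz (v1 v2 : R * R -> R) (d : R) :
  {within stdom T, continuous v1} -> {within stdom T, continuous v2} ->
  (forall z, stdom T z -> `|noise_of v1 z - noise_of v2 z| <= d) ->
  forall z, stdom T z -> `|v1 z - v2 z| <= K * d.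
Proof.
move=> c1 c2 n12.
pose g (z : R * R) := `|v1 z - v2 z| * expR (- ((m + 1) ^+ 2 * z.1)).
pose S := sup (g @` stdom T).
have tpos (z : R * R) : stdom T z -> 0 <= z.1 <= T.
  by case=> /=; rewrite in_itv.
have e1 (z : R * R) : stdom T z -> expR (- ((m + 1) ^+ 2 * z.1)) <= 1.
  by move=> /tpos/andP[? _]; rewrite -expR0 ler_expR oppr_le0 mulr_ge0 ?sqr_ge0.
(* [S] has to be a genuine finite supremum before [S / 2] can be absorbed. *)
have hs : has_sup (g @` stdom T).
  split.
    exists (g (0, 0)), (0, 0) => //.
    by split; rewrite /= in_itv/= lexx ?ler01// ltW.
  have [M1 M10 b1] := within_stdom_bounded _ _ _ c1.
  have [M2 M20 b2] := within_stdom_bounded _ _ _ c2.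
  exists (M1 + M2) => _ [z zT <-]; rewrite /g -[leRHS]mulr1.
  rewrite ler_pM ?expR_ge0 ?e1//.
  by rewrite (le_trans (ler_normB _ _))// lerD ?b1 ?b2.
have gS z : stdom T z -> g z <= S by move=> zT; apply: (ub_le_sup hs.2); exists z.
have S0 : 0 <= S.
  have z0 : stdom T (0, 0) by split; rewrite /= in_itv/= lexx ?ler01// ltW.
  by rewrite (le_trans _ (gS _ z0))// mulr_ge0// expR_ge0.
have vS z : stdom T z -> `|v1 z - v2 z| <= S * expR ((m + 1) ^+ 2 * z.1).
  move=> zT; rewrite -ler_pdivrMr ?expR_gt0//; have := gS _ zT.
  by rewrite /g expRN.
have S2 : S <= 2 * d.
  suff : S <= d + S / 2 by lra.
  apply: ge_sup; first exact: hs.1.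
  move=> _ [z zT <-]; rewrite /g expRN ler_pdivrMr ?expR_gt0//.
  have := heat_conv_lipschitz v1 v2 S z c1 c2 S0 zT vS.
  have := n12 _ zT; rewrite /noise_of => h1 h2.
  have d0 : 0 <= d by exact: le_trans h1.
  rewrite mulrDl [X in `|X|](_ : _ = (v1 z - heat_conv (b \o v1) z.1 z.2 - heat_sg u0 z.1 z.2
    - (v2 z - heat_conv (b \o v2) z.1 z.2 - heat_sg u0 z.1 z.2))
    + (heat_conv (b \o v1) z.1 z.2 - heat_conv (b \o v2) z.1 z.2)); last by ring.
  rewrite (le_trans (ler_normD _ _))// lerD//.
  rewrite (le_trans h1)// ler_peMr// -expR0 ler_expR mulr_ge0 ?sqr_ge0//.
  by case/andP: (tpos _ zT).
have -> : K * d = 2 * d * expR ((m + 1) ^+ 2 * T) by rewrite /K mulrAC.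
move=> z zT; apply: (le_trans (vS _ zT)).
apply: ler_pM => //.
by rewrite ler_expR ler_wpM2l ?sqr_ge0//; case/andP: (tpos _ zT).
Qed.

End solution_map.

(** * Extension of functionals from the range of [A] *)

Section functional_extension.
Context {R : realType} (T : R) (A : (R * R -> R) -> R * R -> R) (C K : R).
Hypothesis K0 : 0 < K.
Hypothesis A_lip : forall (v1 v2 : R * R -> R) (d : R),
  {within stdom T, continuous v1} -> {within stdom T, continuous v2} ->
  0 <= d -> (forall z, stdom T z -> `|v1 z - v2 z| <= d) ->
  forall z, stdom T z -> `|A v1 z - A v2 z| <= d * C.
Hypothesis A_inv_lip : forall (v1 v2 : R * R -> R) (d : R),
  {within stdom T, continuous v1} -> {within stdom T, continuous v2} ->
  (forall z, stdom T z -> `|A v1 z - A v2 z| <= d) ->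
  forall z, stdom T z -> `|v1 z - v2 z| <= K * d.

(* The type [R * R -> R] with the uniform topology. *)
Let X := arrow_uniform_type (R * R)%type R.
(** Setting functions to zero off the rectangle turns uniform closeness in [X] into uniform
    closeness on [stdom T]. *)
Let emb (f : R * R -> R) : X := f \_ (stdom T).
Let range : set X := [set emb (A v) | v in
  [set v : R * R -> R | {within stdom T, continuous v}]].

Let embE f z : stdom T z -> emb f z = f z.
Proof. by move=> zT; rewrite /emb patchE mem_set. Qed.

Lemma eq0_le_harmonic (a c : R) : (forall n, `|a| <= c * n.+1%:R^-1) -> a = 0.
Proof.
move=> h; apply/eqP; rewrite -normr_le0.
have lim0 : (fun n => c * n.+1%:R^-1) @ \oo --> c * 0.
  by apply: cvgM; [exact: cvg_cst|exact: cvg_harmonic].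
rewrite mulr0 in lim0.
by rewrite -(cvg_lim _ lim0)//; apply: limr_ge; [apply/cvg_ex; exists 0|exact: nearW].
Qed.

Lemma near_harmonic_lt (e : R) : 0 < e -> \forall n \near \oo, n.+1%:R^-1 < e.
Proof.
move=> e0; have /cvgrPdist_lt/(_ _ e0) := @cvg_harmonic R.
by apply: filterS => n; rewrite sub0r normrN gtr0_norm// invr_gt0.
Qed.

(** The sequence is Cauchy; letting [k] tend to infinity in the hypothesis gives the rate. *)
Lemma cvg_harmonic_rate (u : nat -> R) (c : R) : 0 < c ->
  (forall n k, `|u n - u k| <= c * (n.+1%:R^-1 + k.+1%:R^-1)) ->
  exists l, forall n, `|u n - l| <= c * n.+1%:R^-1.
Proof.
move=> c0 uc.
have : cvgn u.
  apply/cauchy_cvgP/cauchy_exP => e e0; near \oo => n; exists (u n).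
  have small k : k.+1%:R^-1 < e / c / 2 -> `|u n - u k| < e.
    move=> hk; rewrite (le_lt_trans (uc _ _))// mulrC -ltr_pdivlMr//.
    rewrite (splitr (e / c)) ltrD//.
    by near: n; apply: near_harmonic_lt; rewrite !divr_gt0.
  suff : \forall k \near \oo, `|u n - u k| < e by [].
  by apply: filterS (near_harmonic_lt (e / c / 2) _) => //; rewrite !divr_gt0.
move=> /cvg_ex[l ul]; exists l => n.
apply/ler_addgt0Pr => e e0; near \oo => k.
rewrite (le_trans (ler_distD (u k) _ _))//.
have h1 : `|u k - l| <= e / 2.
  by near: k; apply: cvgr_distC_le; [exact: ul|rewrite divr_gt0].
have h2 : k.+1%:R^-1 <= e / 2 / c.
  by apply: ltW; near: k; apply: near_harmonic_lt; rewrite !divr_gt0.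
rewrite [in leRHS](splitr e) addrA lerD//.
rewrite (le_trans (uc n k))// mulrDr lerD2l.
by rewrite mulrC -ler_pdivlMr.
Unshelve. all: by end_near. Qed.

Lemma within_continuous_harmonic_limit (v : nat -> R * R -> R) (w : R * R -> R) (c : R) :
  0 < c -> (forall n, {within stdom T, continuous (v n)}) ->
  (forall n z, stdom T z -> `|v n z - w z| <= c * n.+1%:R^-1) ->
  {within stdom T, continuous w}.
Proof.
move=> c0 cv vw; apply/subspace_continuousP => z zT; apply/cvgrPdist_lt => e e0.
have e3c : 0 < e / 3 / c by rewrite !divr_gt0.
near \oo => n.
have small : c * n.+1%:R^-1 < e / 3.
  rewrite mulrC -ltr_pdivlMr//.
  by near: n; exact: near_harmonic_lt.
have /subspace_continuousP/(_ z zT)/cvgrPdist_lt/(_ (e / 3)) := cv n.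
have e3 : 0 < e / 3 by rewrite divr_gt0.
move=> /(_ e3).
rewrite !near_withinE; apply: filterS => y /= + yT => /(_ yT) h.
have h1 := vw n z zT; have h2 := vw n y yT.
rewrite (_ : w z - w y = - (v n z - w z) + (v n z - v n y) + (v n y - w y)); last by ring.
rewrite (le_lt_trans (ler_normD _ _))// [ltRHS](_ : _ = e / 3 + e / 3 + e / 3); last by field.
apply: ltrD; last exact: le_lt_trans h2 small.
rewrite (le_lt_trans (ler_normD _ _))// normrN ltrD//.
exact: le_lt_trans h1 small.
Unshelve. all: by end_near. Qed.

(** If [A (v n)] approximates [f] within [1 / (n + 1)], the inverse bound makes [v n] uniformly
    Cauchy. Its limit [w] is continuous, and the Lipschitz bound on [A] gives [f = A w] on the
    rectangle. *)
Let closed_range : closed range.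
Proof.
move=> f clf.
have pick n : exists v, {within stdom T, continuous v} /\
    forall z, `|f z - emb (A v) z| < n.+1%:R^-1.
  have n0 : 0 < n.+1%:R^-1 :> R by rewrite invr_gt0.
  have [_ [[v cv <-] fv]] := clf _ (nbhsx_ballx f _ n0).
  by exists v; split.
have [v hv] := choice pick.
have cv n := (hv n).1; have fv n := (hv n).2.
have fA n z : stdom T z -> `|f z - A (v n) z| < n.+1%:R^-1.
  by move=> zT; have := fv n z; rewrite embE.
have vv n k z : stdom T z -> `|v n z - v k z| <= K * (n.+1%:R^-1 + k.+1%:R^-1).
  apply: A_inv_lip => // y yT.
  rewrite (_ : A _ y - _ = - (f y - A (v n) y) + (f y - A (v k) y)); last by ring.
  rewrite (le_trans (ler_normD _ _))// normrN.
  by rewrite lerD//; apply: ltW; exact: fA.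
have lim z : exists l, stdom T z -> forall n, `|v n z - l| <= K * n.+1%:R^-1.
  have [zT|nzT] := pselect (stdom T z); last by exists 0.
  have [l hl] := cvg_harmonic_rate (fun n => v n z) K K0 (fun n k => vv n k z zT).
  by exists l.
have [w hw] := choice lim.
have vw n z : stdom T z -> `|v n z - w z| <= K * n.+1%:R^-1 by move=> /hw.
have cw := within_continuous_harmonic_limit v w K K0 cv vw.
exists w => //; apply/funext => z.
(* Off the rectangle [f] is a limit of zeros, matching [emb]. *)
have [zT|nzT] := pselect (stdom T z); last first.
  rewrite /emb patchE memNset//; apply/esym/(eq0_le_harmonic _ 1) => n.
  by have := fv n z; rewrite /emb patchE memNset// subr0 mul1r => /ltW.
rewrite embE//; apply/esym/eqP; rewrite -subr_eq0; apply/eqP.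
apply: (eq0_le_harmonic _ (1 + K * C)) => n.
have h1 := fA n z zT.
have k0 : 0 <= K * n.+1%:R^-1 by rewrite mulr_ge0 ?invr_ge0// ltW.
have h2 := A_lip _ _ _ (cv n) cw k0 (vw n) z zT.
rewrite (_ : f z - _ = (f z - A (v n) z) + (A (v n) z - A w z)); last by ring.
rewrite (le_trans (ler_normD _ _))//.
by rewrite mulrDl mul1r (mulrAC K C) lerD// ltW.
Qed.

(** [F] takes functions on the whole plane, but its continuity is tested on [stdom T] only, so it
    cannot separate functions that agree there. *)
Lemma bounded_continuous_eq F f g : bounded_continuous_on_C T F ->
  {within stdom T, continuous f} -> {within stdom T, continuous g} ->
  (forall z, stdom T z -> f z = g z) -> F f = F g.
Proof.
move=> [_ cF] cf cg fg; apply/eqP; rewrite -subr_eq0 -normr_le0.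
apply/ler_addgt0Pr => e e0; rewrite add0r ltW//.
have [del del0] := cF f cf e e0; apply => // z zT.
by rewrite fg// subrr normr0.
Qed.

(** [Psi f] is defined for every [f], and [f] is not asked to be continuous; this suits the
    convolved noises, known only to equal [A v] on the rectangle. *)
Lemma functional_extension F : bounded_continuous_on_C T F ->
  exists2 Psi, bounded_continuous_on_C T Psi &
    forall v f, {within stdom T, continuous v} ->
      (forall z, stdom T z -> f z = A v z) -> Psi f = F v.
Proof.
move=> bF; have [[M FM] cF] := bF.
have sol f : exists v, range f ->
    {within stdom T, continuous v} /\ emb (A v) = f.
  (* The default [cst 0] is harmless: [phi] is used on [range] only. *)
  have [[v cv vf]|nf] := pselect (range f); last by exists (cst 0).
  by exists v.
have [phi hphi] := choice sol.
have c_ext : {within range, continuous (F \o phi : X -> R^o)}.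
  apply/subspace_continuousP => f rf; apply/cvgrPdist_lt => e e0.
  have [cf Af] := hphi f rf.
  have [del del0 hdel] := cF _ cf e e0.
  rewrite near_withinE.
  (* The inverse bound turns this radius into distance at most [del / 2] between the preimages. *)
  have r0 : 0 < del / 2 / K by rewrite !divr_gt0.
  apply: filterS (nbhsx_ballx f _ r0) => g fg rg /=.
  have [cg Ag] := hphi g rg.
  apply: hdel => // z zT.
  apply: (@le_lt_trans _ _ (K * (del / 2 / K))).
    apply: A_inv_lip => // y yT.
    rewrite -(embE (A (phi f)))// -(embE (A (phi g)))// Af Ag.
    by apply: ltW; exact: fg.
  rewrite mulrC divfK ?gt_eqF//.
  by rewrite ltr_pdivrMr// ltr_pMr// ltr1n.
(* The extension theorem is applied with a positive bound, hence the maximum with 1. *)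
have M0 : 0 < Num.max 1 M by rewrite lt_max ltr01.
have bM f : range f -> `|(F \o phi) f| <= Num.max 1 M.
  by move=> /hphi[cf _]; rewrite le_max FM ?orbT.
have [G [GE cG GM]] := continuous_bounded_extension pseudometric_normal
  closed_range M0 c_ext bM.
exists (fun f => G (emb f)).
  split; first by exists (Num.max 1 M) => f _.
  move=> f _ e e0.
  have /cvgrPdist_lt/(_ e e0) := cG (emb f).
  rewrite -nbhs_ballE => -[del /= del0 hdel]; exists del => // g _ fg.
  apply: hdel => z; rewrite /ball/= /emb !patchE.
  by case: ifPn => [/set_mem/fg//|_]; rewrite subrr normr0.
move=> v f cv fA.
have fE : emb f = emb (A v).
  by apply/funext => z; rewrite /emb !patchE; case: ifPn => // /set_mem/fA.
have rf : range (emb f) by rewrite fE; exists v.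
rewrite -GE ?inE//=; have [cphi Aphi] := hphi _ rf.
(* The inverse bound with [d = 0] shows that the chosen preimage agrees with [v] on the
   rectangle. *)
apply: bounded_continuous_eq => // z zT; apply/eqP; rewrite -subr_eq0 -normr_le0.
rewrite -(mulr0 K); apply: A_inv_lip zT => // y yT.
by rewrite -(embE (A _))// Aphi embE// fA// subrr normr0.
Qed.

End functional_extension.

(** * Convergence in law of the mild solutions *)

Theorem theorem3p5 (R : realType) (T : R) (u0 b : R -> R)
  (dn : nat -> measure_display) (Om : forall n, measurableType (dn n))
  (Pn : forall n, probability (Om n) R)
  (theta : forall n, Om n -> R * R -> R)
  (d' : measure_display) (Om' : measurableType d') (P' : probability Om' R)
  (W : (R * R -> R) -> Om' -> R)
  (Un : forall n, Om n -> R * R -> R) (U : Om' -> R * R -> R) :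
  0 < T ->
  {within `[0, 1], continuous u0} ->
  (exists L : R, forall x y, `|b x - b y| <= L * `|x - y|) ->
  (* theta_n are (jointly measurable) stochastic processes, a.s. in L^2 *)
  (forall n, measurable_fun setT (fun p : Om n * (R * R) => theta n p.1 p.2)) ->
  (forall n, {ae Pn n, forall w, sq_int T (theta n w)}) ->
  (* W is a space-time white noise (Brownian sheet) on [0,T] x [0,1] *)
  white_noise P' T W ->
  (* X_n converges in law in C([0,T] x [0,1]) to X *)
  conv_law T Pn (fun n w z => heat_conv (theta n w) z.1 z.2)
    P' (fun w z => stoch_conv W z w) ->
  (* U_n is the a.s. continuous mild solution driven by theta_n *)
  (forall n, random_field (Un n) /\
     {ae Pn n, forall w, {within stdom T, continuous (Un n w)} /\
        forall t x, stdom T (t, x) ->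
          Un n w (t, x) = heat_sg u0 t x + heat_conv (fun z => b (Un n w z)) t x
                          + heat_conv (theta n w) t x}) ->
  (* U is the continuous adapted mild solution driven by W *)
  random_field U ->
  (forall t x, stdom T (t, x) -> forall A : set R, measurable A ->
     nat_filtration P' W t ((fun w => U w (t, x)) @^-1` A)) ->
  (forall w, {within stdom T, continuous (U w)}) ->
  {ae P', forall w, forall t x, stdom T (t, x) ->
     U w (t, x) = heat_sg u0 t x + heat_conv (fun z => b (U w z)) t x
                  + stoch_conv W (t, x) w} ->
  (* conclusion: U_n converges in law in C([0,T] x [0,1]) to U *)
  conv_law T Pn Un P' U.
Proof.
move=> T0 _ [L bL] _ _ _ cvX hUn _ _ cU hU F bF.
pose L' := `|L|.
have bL' x y : `|b x - b y| <= L' * `|x - y|.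
  by rewrite (le_trans (bL x y))// ler_wpM2r// ler_norm.
have L0 : 0 <= L' := normr_ge0 L.
(* This is the constant [K] of [noise_of_inv_lipschitz], with [m = 8 * L' + 1] unfolded. *)
have K0 : 0 < 2 * expR ((8 * L' + 1 + 1) ^+ 2 * T) by rewrite mulr_gt0 ?expR_gt0.
have [Psi bPsi PsiE] := functional_extension T (noise_of u0 b) _ _ K0
  (noise_of_lipschitz T L' u0 b T0 L0 bL')
  (noise_of_inv_lipschitz T L' u0 b T0 L0 bL') F bF.
(* The mild equation says that [noise_of] sends [Un n w] to the convolved noise for almost every
   [w], which suffices under the integral. *)
rewrite (_ : (fun n => _) = fun n =>
    \int[Pn n]_w Psi (fun z => heat_conv (theta n w) z.1 z.2)); last first.
  apply/funext => n; apply: eq_Rintegral_ae.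
  have [_] := hUn n; apply: filterS => w [cw eqw].
  apply/esym/PsiE => // -[t x] zT; rewrite /noise_of/= eqw//; ring.
rewrite (_ : \int[P']_w F (U w) = \int[P']_w Psi (fun z => stoch_conv W z w)).
  exact: cvX.
apply: eq_Rintegral_ae; apply: filterS hU => w eqw.
symmetry; apply: PsiE; first exact: (cU w).
by move=> [t x] zT; rewrite /noise_of/= eqw//; ring.
Qed.
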